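(* Let $\mathcal{K}$ be a class of contexts. Then the sequent $\top\sqcap\top\dashv\vdash\bot\sqcup\bot$ (i.e. both sequents $\top\sqcap\top\vdash\bot\sqcup\bot$ and $\bot\sqcup\bot\vdash\top\sqcap\top$) is valid in $\mathcal{K}$ if and only if every context $(G,M,R)$ in $\mathcal{K}$ satisfies $R=G\times M$.
   Context: Formulae of PDBL are built from object variables $\mathbf{OV}$, property variables $\mathbf{PV}$ (disjoint countably infinite sets), constants $\top,\bot$, binary connectives $\sqcap,\sqcup$ and unary connectives $\neg,\lrcorner$. A context is $\mathbb{K}=(G,M,R)$ with sets $G,M$ and $R\subseteq G\times M$. For $A\subseteq G$, $A'=\{m\in M:gRm\ \forall g\in A\}$; for $B\subseteq M$, $B'=\{g\in G:gRm\ \forall m\in B\}$. A semiconcept is a pair $(A,B)$ with $A'=B$ or $B'=A$; $\mathfrak{H}(\mathbb{K})$ is the set of semiconcepts, $ext(A,B)=A$, $int(A,B)=B$, with $(A_1,B_1)\sqcap(A_2,B_2)=(A_1\cap A_2,(A_1\cap A_2)')$ and $(A_1,B_1)\sqcup(A_2,B_2)=((B_1\cap B_2)',B_1\cap B_2)$. A model is $\mathbb{M}=(\mathbb{K},v)$ with $v$ a map on $\mathbf{OV}\cup\mathbf{PV}\cup\{\top,\bot\}$ into $\mathfrak{H}(\mathbb{K})$ with $v(p)\sqcap v(p)=v(p)$ ($p\in\mathbf{OV}$), $v(P)\sqcup v(P)=v(P)$ ($P\in\mathbf{PV}$), $v(\top)=(G,\emptyset)$, $v(\bot)=(\emptyset,M)$.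 Satisfaction $g\models\alpha$ ($g\in G$) and co-satisfaction $m\succ\alpha$ ($m\in M$) in $\mathbb{M}$: $g\models p$ iff $g\in ext(v(p))$; $g\models P$ iff $g\in ext(v(P))$; $g\models\top$ always; $g\not\models\bot$ always; $m\not\succ\top$ always; $m\succ\bot$ always; $g\models\alpha\sqcap\beta$ iff $g\models\alpha$ and $g\models\beta$; $g\models\neg\alpha$ iff $g\not\models\alpha$; $m\succ p$ iff $m\in int(v(p))$; $m\succ P$ iff $m\in int(v(P))$; $m\succ\alpha\sqcup\beta$ iff $m\succ\alpha$ and $m\succ\beta$; $m\succ\lrcorner\alpha$ iff $m\not\succ\alpha$; $g\models\alpha\sqcup\beta$ iff $\forall m\in M(m\succ\alpha\sqcup\beta\Rightarrow gRm)$; $g\models\lrcorner\alpha$ iff $\forall m(m\not\succ\alpha\Rightarrow gRm)$; $m\succ\neg\alpha$ iff $\forall g(g\not\models\alpha\Rightarrow gRm)$; $m\succ\alpha\sqcap\beta$ iff $\forall g(g\models\alpha\sqcap\beta\Rightarrow gRm)$. A sequent $\alpha\vdash\beta$ is satisfied in $\mathbb{M}$ iff $\forall g(g\models\alpha\Rightarrow g\models\beta)$ and $\forall m(m\succ\beta\Rightarrow m\succ\alpha)$; it is true in $\mathbb{K}$ if satisfied in every model based on $\mathbb{K}$, and valid in a class of contexts if true in each member. *)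

(* Defs.v *)
From mathcomp Require Import all_boot.
From mathcomp Require Import boolp classical_sets.

Set Implicit Arguments.
Unset Strict Implicit.
Unset Printing Implicit Defensive.

Local Open Scope classical_set_scope.

(* The sets G and M are rendered as types; either may be empty. *)
Record context := Context {
  obj : Type;
  attr : Type;
  inc : set (obj * attr)
}.

Arguments inc : clear implicits.

Section Semiconcepts.
Variable K : context.

Definition intent (A : set (obj K)) : set (attr K) :=
  [set m | forall g, A g -> inc K (g, m)].

Definition extent (B : set (attr K)) : set (obj K) :=
  [set g | forall m, B m -> inc K (g, m)].

Definition is_semiconcept (x : set (obj K) * set (attr K)) : Prop :=
  intent x.1 = x.2 \/ extent x.2 = x.1.

Definition semi_meet (x y : set (obj K) * set (attr K)) :=
  (x.1 `&` y.1, intent (x.1 `&` y.1)).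

Definition semi_join (x y : set (obj K) * set (attr K)) :=
  (extent (x.2 `&` y.2), x.2 `&` y.2).

End Semiconcepts.

(* Object and property variables are two copies of nat, kept disjoint by the
   constructors; [atom] is OV + PV + {top, bottom}, the domain of valuations. *)
Inductive atom : Type :=
| ovar (n : nat)
| pvar (n : nat)
| top
| bot.

(* [fneg] is \neg and [fopp] is \lrcorner. *)
Inductive formula : Type :=
| fatom (a : atom)
| fmeet (a b : formula)
| fjoin (a b : formula)
| fneg (a : formula)
| fopp (a : formula).

Definition ftop : formula := fatom top.
Definition fbot : formula := fatom bot.

Record sequent := Sequent { antecedent : formula; succedent : formula }.

Record model (K : context) := Model {
  valuation : atom -> set (obj K) * set (attr K);
  val_semiconcept : forall a, is_semiconcept (valuation a);
  val_ovar : forall n, semi_meet (valuation (ovar n)) (valuation (ovar n)) = valuation (ovar n);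
  val_pvar : forall n, semi_join (valuation (pvar n)) (valuation (pvar n)) = valuation (pvar n);
  val_top : valuation top = ([set: obj K], set0);
  val_bot : valuation bot = (set0, [set: attr K])
}.

Section Satisfaction.
Variables (K : context) (V : model K).

(* In the clauses for [sat (fjoin a b)] and [cosat (fmeet a b)], co-satisfaction
   of the join (resp. satisfaction of the meet) is unfolded so that the
   recursion is structural; see [sat_fjoin] and [cosat_fmeet]. *)
Fixpoint sat (f : formula) (g : obj K) {struct f} : Prop :=
  match f with
  | fatom (ovar n) => (valuation V (ovar n)).1 g
  | fatom (pvar n) => (valuation V (pvar n)).1 g
  | fatom top => True
  | fatom bot => False
  | fmeet a b => sat a g /\ sat b g
  | fneg a => ~ sat a g
  | fjoin a b => forall m, cosat a m /\ cosat b m -> inc K (g, m)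
  | fopp a => forall m, ~ cosat a m -> inc K (g, m)
  end
with cosat (f : formula) (m : attr K) {struct f} : Prop :=
  match f with
  | fatom (ovar n) => (valuation V (ovar n)).2 m
  | fatom (pvar n) => (valuation V (pvar n)).2 m
  | fatom top => False
  | fatom bot => True
  | fjoin a b => cosat a m /\ cosat b m
  | fopp a => ~ cosat a m
  | fmeet a b => forall g, sat a g /\ sat b g -> inc K (g, m)
  | fneg a => forall g, ~ sat a g -> inc K (g, m)
  end.

Lemma sat_fjoin a b g :
  sat (fjoin a b) g <-> forall m, cosat (fjoin a b) m -> inc K (g, m).
Proof. by []. Qed.

Lemma cosat_fmeet a b m :
  cosat (fmeet a b) m <-> forall g, sat (fmeet a b) g -> inc K (g, m).
Proof. by []. Qed.

Definition satisfied (s : sequent) : Prop :=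
  (forall g, sat (antecedent s) g -> sat (succedent s) g) /\
  (forall m, cosat (succedent s) m -> cosat (antecedent s) m).

End Satisfaction.

Definition true_in (K : context) (s : sequent) : Prop :=
  forall V : model K, satisfied V s.

Definition valid (C : context -> Prop) (s : sequent) : Prop :=
  forall K, C K -> true_in K s.

(* Main.v *)
Require Import Defs.
From mathcomp Require Import all_boot.
From mathcomp Require Import boolp classical_sets.

Local Open Scope classical_set_scope.

(** Every object satisfies $\top\sqcap\top$, whereas $g$ satisfies $\bot\sqcup\bot$ exactly when $g$
    is related to every attribute. So in any single model, and [model_exists] supplies one,
    $\top\sqcap\top\vdash\bot\sqcup\bot$ says that $R$ is full. *)

Lemma intent_set0 (K : context) : intent (set0 : set (obj K)) = setT.
Proof. by apply/seteqP; split=> // x _ y []. Qed.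

Lemma extent_set0 (K : context) : extent (set0 : set (attr K)) = setT.
Proof. by apply/seteqP; split=> // x _ y []. Qed.

(* Validity over [K] has no content unless [K] carries a model: bottom is
   meet-idempotent and top is join-idempotent, so they can serve as the values
   of the object and property variables. *)
Lemma model_exists (K : context) : inhabited (model K).
Proof.
pose vtop : set (obj K) * set (attr K) := (setT, set0).
pose vbot : set (obj K) * set (attr K) := (set0, setT).
pose v a := match a with ovar _ | bot => vbot | pvar _ | top => vtop end.
constructor; apply: (@Model K v) => //.
- by case=> [n|n||]; [left|right|right|left];
    rewrite /= ?intent_set0 ?extent_set0.
- by move=> n; rewrite /semi_meet /= setIid intent_set0.
- by move=> n; rewrite /semi_join /= setIid extent_set0.
Qed.

Theorem theorem68 (C : context -> Prop) :
  valid C (Sequent (fmeet ftop ftop) (fjoin fbot fbot)) /\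
  valid C (Sequent (fjoin fbot fbot) (fmeet ftop ftop))
  <->
  (forall K : context, C K -> inc K = [set: obj K] `*` [set: attr K]).
Proof.
split=> [[Vtb _] K CK | full].
  have [V] := model_exists K; have [sat_tb _] := Vtb K CK V.
  by apply/seteqP; split=> // -[g m] _; apply: sat_tb.
(* Both halves of the first sequent unfold to [inc K] at an arbitrary pair; those of the second have
   trivially true conclusions. *)
by split=> K CK V; split=> //= x _ y _; rewrite (full K CK).
Qed.
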